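(* Let $\gamma$ be the restriction to $\mathbb S_+^d$ of a norm on $\mathbb S^d$, and assume $\gamma$ is monotone ($0\preceq S\preceq S'$ implies $\gamma(S)\le\gamma(S')$). Then $\mathsf W_\gamma$ is a distance on $\mathcal P_2(\mathbb R^d)$, and it induces the same topology as $\mathsf W_2$.
   Context: $\mathbb S^d$ is the space of real symmetric $d\times d$ matrices, $\mathbb S_+^d$ the cone of positive semidefinite ones, $\preceq$ the Loewner order. $\mathcal P_2(\mathbb R^d)$ is the set of Borel probability measures with finite second moment; $\mathsf W_2$ is the usual quadratic Wasserstein distance. The static Spectral Wasserstein cost $\mathsf W_\gamma\ge0$ is defined by $\mathsf W_\gamma(\mu,\nu)^2=\inf_{\pi\in\Pi(\mu,\nu)}\gamma\left(\int (y-x)(y-x)^\top\,d\pi(x,y)\right)$, where $\Pi(\mu,\nu)$ is the set of couplings of $\mu$ and $\nu$. *)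

(* Defs.v *)
From HB Require Import structures.
From mathcomp Require Import all_boot all_order all_algebra.
From mathcomp Require Import all_classical all_reals all_analysis.

Set Implicit Arguments.
Unset Strict Implicit.
Unset Printing Implicit Defensive.

Import Order.TTheory GRing.Theory Num.Theory.
Import numFieldNormedType.Exports.

Local Open Scope classical_set_scope.
Local Open Scope ring_scope.

Section symmetric_matrices.
Variables (R : realType) (d : nat).
Implicit Types (A B S : 'M[R]_d) (N : 'M[R]_d -> R).

Definition psd S : Prop :=
  S \is symmetricmx /\ forall v : 'cV[R]_d, 0 <= (v^T *m S *m v) 0 0.

Definition loewner A B : Prop := psd (B - A).

(* [N] is a norm on the space of symmetric matrices; its values on the other
   matrices are irrelevant. *)
Record norm_on_sym N : Prop := NormOnSym {
  norm_on_sym_ge0 : forall A, A \is symmetricmx -> 0 <= N A ;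
  norm_on_sym_eq0 : forall A, A \is symmetricmx -> N A = 0 -> A = 0 ;
  norm_on_symZ : forall (a : R) A, A \is symmetricmx ->
    N (a *: A) = `|a| * N A ;
  norm_on_symD : forall A B, A \is symmetricmx -> B \is symmetricmx ->
    N (A + B) <= N A + N B }.

End symmetric_matrices.

Section wasserstein.
Variables (R : realType) (d : nat).

(* R^d with its Borel sigma-algebra *)
Definition Rd := g_sigma_algebraType (@open 'cV[R]_d).

Definition sqnorm (x : 'cV[R]_d) : R := \sum_(i < d) x i 0 ^+ 2.

Record P2 := MkP2 {
  P2_prob :> probability Rd R ;
  P2_moment : (\int[P2_prob]_x (sqnorm x)%:E < +oo)%E }.

(* A [probability] also assigns (unconstrained) values to non-measurable sets,
   so equality of measures is equality on the Borel sets rather than [=]. *)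
Definition same_measure (mu nu : P2) : Prop :=
  forall A : set Rd, measurable A -> mu A = nu A.

(* The product sigma-algebra on Rd * Rd is the Borel one, because R^d is second
   countable. *)
Definition couplings (mu nu : probability Rd R) :
    set (probability (Rd * Rd)%type R) :=
  [set pi | (forall A, measurable A -> pi (A `*` setT) = mu A) /\
            (forall B, measurable B -> pi (setT `*` B) = nu B)].

Definition displacement (z : Rd * Rd) : 'cV[R]_d :=
  (z.2 : 'cV[R]_d) - (z.1 : 'cV[R]_d).

(* The entries are integrable as soon as both marginals have a finite second
   moment, so that the real-valued integral is the genuine one. *)
Definition displacement_mx (pi : probability (Rd * Rd)%type R) : 'M[R]_d :=
  \matrix_(i, j) \int[pi]_z (displacement z *m (displacement z)^T) i j.

(* For [gamma] nonnegative on psd matrices and [mu], [nu] in P2, the set below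
   is nonempty and bounded from below, so that [inf] is its greatest lower
   bound. *)
Definition spectral_W (gamma : 'M[R]_d -> R) (mu nu : P2) : R :=
  Num.sqrt (inf [set gamma (displacement_mx pi) | pi in couplings mu nu]).

Definition W2 (mu nu : P2) : R :=
  Num.sqrt (fine (ereal_inf
    [set (\int[pi]_z (sqnorm (displacement z))%:E)%E |
       pi in couplings mu nu])).

End wasserstein.

(* The axioms of a distance on the set T modulo the equality [eqT]. *)
Record is_distance (R : realType) (T : Type) (eqT : T -> T -> Prop)
    (D : T -> T -> R) : Prop := IsDistance {
  is_distance_ge0 : forall x y, 0 <= D x y ;
  is_distance_eq0 : forall x y, D x y = 0 <-> eqT x y ;
  is_distance_sym : forall x y, D x y = D y x ;
  is_distance_triangle : forall x y z, D x z <= D x y + D y z }.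

(* The topology induced by D, as the family of its open sets; for a distance
   modulo [eqT], these are automatically stable under [eqT]. *)
Definition induced_topology (R : realType) (T : Type) (D : T -> T -> R) :
    set (set T) :=
  [set U | forall x, U x ->
     exists2 e : R, 0 < e & forall y, D x y < e -> U y].

(* Main.v *)
Require Import Defs.
From HB Require Import structures.
From mathcomp Require Import all_boot all_order all_algebra.
From mathcomp Require Import all_classical all_reals all_analysis.
From mathcomp Require Import measurable_realfun ring lra.
Set Implicit Arguments.
Unset Strict Implicit.
Unset Printing Implicit Defensive.
Import Order.TTheory GRing.Theory Num.Theory.
Import numFieldNormedType.Exports.
Local Open Scope classical_set_scope.
Local Open Scope ring_scope.

(** Everything rests on the second moment matrix E[f f^T] of a square integrable
random vector f, since the cost of a coupling is gamma of the second moment matrix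
of its displacement y - x.

Triangle inequality.  For t > 0 one has, in the Loewner order,
(u + v)(u + v)^T <= (1 + t) u u^T + (1 + 1/t) v v^T, hence the same bound for second
moment matrices.  Monotonicity of gamma and the choice of t as the ratio of the two
norms make f |-> sqrt (gamma (E[f f^T])) satisfy Minkowski's inequality
([spectral_minkowski]).  To compose a coupling of (mu, nu) with one of (nu, rho), one
would glue them along nu by disintegration.  As the cost is an infimum, an
approximate gluing is enough: cut R^d into countably many cubes of side eta, and make
the two couplings conditionally independent given the cube that contains the middle
point ([discrete_gluing]).  Both couplings are kept as exact marginals, while the two
copies y, y' of the middle point are only known to lie in the same cube.  The
displacement is then (y - x) + (z - y') + (y' - y) with a last term of norm O(eta), so
that Minkowski's inequality gives the claim as eta tends to 0 ([couplings_compose]).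

Comparison with W_2.  By equivalence of norms on the finite-dimensional space of
symmetric matrices, gamma is comparable to the trace on positive semidefinite
matrices ([norm_on_sym_trace_equiv]), and the trace is the gamma of W_2 ([W2E]).  So
W_gamma and W_2 bound each other up to constants, and the topologies agree.

Separation.  If W_gamma vanishes, there are couplings whose displacement has
arbitrarily small second moment.  Markov's inequality then gives mu U <= nu U for
every open U, after exhausting U by the points at distance at least 1/n from its
complement ([couplings_null_le]); by symmetry mu and nu agree on open sets, hence on
Borel sets. *)

(** * Norms on a finite-dimensional space *)

Section norm_equivalence.
Variables (R : realType) (n : nat) (p : 'rV[R]_n -> R).
Hypothesis pZ : forall a v, p (a *: v) = `|a| * p v.
Hypothesis pD : forall u v, p (u + v) <= p u + p v.

Let p0 : p 0 = 0.
Proof. by rewrite -(scale0r 0) pZ normr0 mul0r. Qed.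

Let p_ge0 v : 0 <= p v.
Proof.
have := pD v (- v); rewrite subrr p0 -scaleN1r pZ normrN1 mul1r.
by rewrite -mulr2n pmulrn_lge0.
Qed.

Lemma seminorm_rV_le : exists2 C, 0 < C & forall v, p v <= C * `|v|.
Proof.
exists (1 + \sum_(j < n) p 'e_j).
  by rewrite ltr_pwDl// sumr_ge0.
move=> v; rewrite {1}(row_sum_delta v).
have psum (I : Type) (r : seq I) (F : I -> 'rV[R]_n) :
    p (\sum_(i <- r) F i) <= \sum_(i <- r) p (F i).
  elim: r => [|i r IH]; first by rewrite !big_nil p0.
  by rewrite !big_cons (le_trans (pD _ _))// lerD2l.
apply: le_trans (psum _ _ _) _.
rewrite mulrDl mul1r mulr_suml -[leLHS]add0r lerD//.
apply: ler_sum => j _; rewrite pZ mulrC ler_wpM2l//.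
rewrite [leRHS]/Num.Def.normr/= mx_normrE.
exact: (le_bigmax _ (fun ij : 'I_1 * 'I_n => `|v ij.1 ij.2|) (ord0, j)).
Qed.

Lemma seminorm_rV_continuous : continuous p.
Proof.
have [C C0 pC] := seminorm_rV_le.
move=> u; apply/(@cvgrPdist_le _ _ _ (nbhs u)) => e e0.
apply/nbhs_ballP; exists (e / C); first by rewrite /= divr_gt0.
move=> v; rewrite mx_norm_ball /ball_/= => uv.
have h (x y : 'rV[R]_n) : p x - p y <= C * `|x - y|.
  by rewrite lerBlDr (le_trans _ (lerD (pC _) (lexx _)))// -{1}(subrK y x).
have {}uv : C * `|u - v| <= e by rewrite mulrC -ler_pdivlMr// ltW.
rewrite ler_norml; apply/andP; split; last exact: le_trans (h _ _) uv.
by rewrite lerNl opprB (le_trans (h _ _))// distrC.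
Qed.

(** The continuous function [p] attains a positive minimum on the compact unit
sphere; homogeneity does the rest. *)
Lemma norm_rV_ge : (forall v, p v = 0 -> v = 0) ->
  exists2 c, 0 < c & forall v, c * `|v| <= p v.
Proof.
move=> p_eq0.
(* For n = 0 the unit sphere is empty, so this case is separate. *)
have [allv0|/existsNP[w /eqP w0]] := pselect (forall v : 'rV[R]_n, v = 0).
  by exists 1 => // v; rewrite (allv0 v) normr0 mulr0 p0.
pose K := [set v : 'rV[R]_n | `|v| = 1].
have unitK (v : 'rV[R]_n) : v != 0 -> K (`|v|^-1 *: v).
  by move=> v0; rewrite /K/= normrZ normfV normr_id mulVf// normr_eq0.
have cK : compact K.
  apply: bounded_closed_compact.
    exists 1; split => // M M1 v /= ->; exact: ltW.
  apply: (@closed_comp _ _ (fun v : 'rV[R]_n => `|v|) [set 1]) => //.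
    by move=> v _; exact: norm_continuous.
have [||c /set_mem Kc cmin] := @EVT_min_rV _ _ p K _ cK.
- by exists (`|w|^-1 *: w); exact: unitK.
- by apply: continuous_subspaceT; exact: seminorm_rV_continuous.
exists (p c).
  rewrite lt_neqAle p_ge0 andbT eq_sym; apply/eqP => /p_eq0 c0.
  by move: Kc; rewrite /K/= c0 normr0 => /eqP; rewrite eq_sym oner_eq0.
move=> v; have [->|v0] := eqVneq v 0; first by rewrite normr0 mulr0 p0.
have := cmin _ (mem_set (unitK _ v0)).
by rewrite pZ normfV normr_id mulrC ler_pdivlMr ?normr_gt0.
Qed.

End norm_equivalence.

(** * Positive semidefinite matrices *)

Section psd_matrices.
Variables (R : realType) (d : nat).
Implicit Types (S A B : 'M[R]_d) (v : 'cV[R]_d).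

Lemma symmetricmxP A : reflect (A^T = A) (A \is symmetricmx).
Proof.
by rewrite qualifE/= expr0 scale1r map_mx_id// eq_sym; exact: eqP.
Qed.

Lemma symmetricmxD A B : A \is symmetricmx -> B \is symmetricmx ->
  A + B \is symmetricmx.
Proof.
by move=> /symmetricmxP sA /symmetricmxP sB; apply/symmetricmxP; rewrite linearD/= sA sB.
Qed.

Lemma symmetricmxZ a A : A \is symmetricmx -> a *: A \is symmetricmx.
Proof. by move=> /symmetricmxP sA; apply/symmetricmxP; rewrite linearZ/= sA. Qed.

Lemma psdD A B : psd A -> psd B -> psd (A + B).
Proof.
move=> [sA pA] [sB pB]; split; first exact: symmetricmxD.
by move=> v; rewrite mulmxDr mulmxDl mxE addr_ge0.
Qed.

Lemma psdZ a A : 0 <= a -> psd A -> psd (a *: A).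
Proof.
move=> a0 [sA pA]; split; first exact: symmetricmxZ.
by move=> v; rewrite -scalemxAr -scalemxAl mxE mulr_ge0.
Qed.

Lemma qform_delta A i j :
  ((delta_mx i 0 : 'cV[R]_d)^T *m A *m (delta_mx j 0 : 'cV[R]_d)) 0 0 = A i j.
Proof. by rewrite trmx_delta -rowE -colE !mxE. Qed.

Lemma psd_diag_ge0 S i : psd S -> 0 <= S i i.
Proof. by move=> [_ /(_ (delta_mx i 0))]; rewrite qform_delta. Qed.

Lemma mxtrace_psd_ge0 S : psd S -> 0 <= \tr S.
Proof. by move=> pS; apply: sumr_ge0 => i _; exact: psd_diag_ge0. Qed.

(** The quadratic form is nonnegative at e_i + e_j and at e_i - e_j. *)
Lemma psd_entry_le S i j : psd S -> 2 * `|S i j| <= S i i + S j j.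
Proof.
move=> [/symmetricmxP sS pS].
have Sji : S j i = S i j by rewrite -[in LHS]sS mxE.
have q e : ((delta_mx i 0 + e *: delta_mx j 0 : 'cV[R]_d)^T *m S *m
     (delta_mx i 0 + e *: delta_mx j 0 : 'cV[R]_d)) 0 0 = S i i + 2 * e * S i j + e ^+ 2 * S j j.
  have mxD (A B : 'M[R]_1) : (A + B) 0 0 = A 0 0 + B 0 0 by rewrite mxE.
  have mxZ a (A : 'M[R]_1) : (a *: A) 0 0 = a * A 0 0 by rewrite mxE.
  rewrite [(_ + _)^T]linearD/= [(_ *: _)^T]linearZ/= mulmxDr !mulmxDl -!(scalemxAl, scalemxAr).
  by rewrite !(mxD, mxZ) !qform_delta Sji; ring.
have := pS (delta_mx i 0 + 1 *: delta_mx j 0); rewrite q => h1.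
have := pS (delta_mx i 0 + (-1) *: delta_mx j 0); rewrite q => h2.
by case: ger0P => ?; lra.
Qed.

Lemma psd_norm_le_trace S : psd S -> `|S| <= \tr S.
Proof.
move=> pS; rewrite [leLHS]/Num.Def.normr/= mx_normrE.
apply/bigmax_leP; split; first exact: mxtrace_psd_ge0.
move=> [i j] _ /=; have := psd_entry_le i j pS.
have le_tr k : S k k <= \tr S.
  by rewrite /mxtrace (bigD1 k)//= lerDl sumr_ge0// => l _; exact: psd_diag_ge0.
by have := le_tr i; have := le_tr j; lra.
Qed.

Lemma trace_le_norm S : \tr S <= d%:R * `|S|.
Proof.
rewrite mulr_natl -[X in _ *+ X]card_ord -sumr_const; apply: ler_sum => i _.
rewrite (le_trans (ler_norm _))// [leRHS]/Num.Def.normr/= mx_normrE.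
exact: (le_bigmax _ (fun ij : 'I_d * 'I_d => `|S ij.1 ij.2|) (i, i)).
Qed.

Lemma normr_mxvec S : `|mxvec S| = `|S|.
Proof.
rewrite /Num.Def.normr/= !mx_normrE; apply/eqP; rewrite eq_le; apply/andP; split.
  apply/bigmax_leP; split; first exact: bigmax_ge_id.
  move=> [i k] _ /=; rewrite ord1; case/mxvec_indexP: k => k l.
  rewrite mxvecE.
  exact: (le_bigmax _ (fun ij : 'I_d * 'I_d => `|S ij.1 ij.2|) (k, l)).
apply/bigmax_leP; split; first exact: bigmax_ge_id.
move=> [i k] _ /=; rewrite -mxvecE.
exact: (le_bigmax _ (fun ij : 'I_1 * 'I_(d * d) => `|mxvec S ij.1 ij.2|)
  (ord0, mxvec_index i k)).
Qed.

(** On positive semidefinite matrices the trace is comparable to the largest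
entry, so this is the equivalence of norms.  Adding the size of the antisymmetric
part extends [N] to a norm on all of R^(d * d), where the equivalence is known. *)
Lemma norm_on_sym_trace_equiv (N : 'M[R]_d -> R) : norm_on_sym N ->
  exists c C, [/\ 0 < c, 0 < C & forall S, psd S -> c * \tr S <= N S <= C * \tr S].
Proof.
move=> [N_ge0 N_eq0 NZ ND].
pose sy A := A + A^T.
have sy_sym A : sy A \is symmetricmx.
  by apply/symmetricmxP; rewrite linearD/= trmxK addrC.
pose p (v : 'rV[R]_(d * d)) := N (sy (vec_mx v)) + `|vec_mx v - (vec_mx v)^T|.
have pZ a (v : 'rV_(d * d)) : p (a *: v) = `|a| * p v.
  rewrite /p linearZ/= mulrDr -NZ//; congr (N _ + _).
    by rewrite /sy linearZ/= scalerDr.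
  by rewrite linearZ/= -scalerBr normrZ.
have pD (u v : 'rV_(d * d)) : p (u + v) <= p u + p v.
  rewrite /p addrACA lerD//.
    rewrite (_ : sy _ = sy (vec_mx u) + sy (vec_mx v)) ?ND//.
    by rewrite /sy !linearD/= addrACA.
  by rewrite !linearD/= addrACA ler_normD.
have p_eq0 (v : 'rV_(d * d)) : p v = 0 -> v = 0.
  move=> /eqP; rewrite paddr_eq0 ?N_ge0// normr_eq0 subr_eq0.
  move=> /andP[/eqP/(N_eq0 _ (sy_sym _)) + /eqP vT].
  rewrite /sy -vT -mulr2n -scaler_nat => /eqP; rewrite scaler_eq0 pnatr_eq0/= => /eqP v0.
  by rewrite -(vec_mxK v) v0 linear0.
have [C C0 pC] := seminorm_rV_le pZ pD.
have [c c0 pc] := norm_rV_ge pZ pD p_eq0.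
have pS S : psd S -> p (mxvec S) = 2 * N S.
  move=> [symS _]; have /symmetricmxP sS := symS.
  rewrite /p mxvecK /sy sS subrr normr0 addr0 -mulr2n -scaler_nat NZ//.
  by rewrite ger0_norm.
exists (c / (2 * d.+1%:R)), (C / 2); split; [by rewrite divr_gt0// mulr_gt0|by rewrite divr_gt0|].
move=> S psdS; have := pC (mxvec S); have := pc (mxvec S); rewrite normr_mxvec pS// => h1 h2.
have h3 := psd_norm_le_trace psdS; have h4 := trace_le_norm S.
have h5 : C * `|S| <= C * \tr S by rewrite ler_pM2l.
apply/andP; split; last by lra.
rewrite mulrAC ler_pdivrMr ?mulr_gt0//.
have h6 : \tr S <= d.+1%:R * `|S| by rewrite (le_trans h4)// ler_wpM2r// ler_nat.
have h7 : c * \tr S <= d.+1%:R * (c * `|S|) by rewrite mulrCA ler_pM2l.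
have h8 : d.+1%:R * (c * `|S|) <= d.+1%:R * (2 * N S) by rewrite ler_pM2l.
have -> : N S * (2 * d.+1%:R) = d.+1%:R * (2 * N S) by ring.
exact: le_trans h7 h8.
Qed.

End psd_matrices.

(** * Second moment matrices *)

Section square_integrable.
Context dT (T : measurableType dT) (R : realType) (P : probability T R).
Implicit Types f g : T -> R.

Definition sqintegrable f :=
  measurable_fun setT f /\ P.-integrable setT (fun x => (f x ^+ 2)%:E).

Lemma sqintegrable_mul f g : sqintegrable f -> sqintegrable g ->
  P.-integrable setT (fun x => (f x * g x)%:E).
Proof.
move=> [mf if2] [mg ig2].
apply: (@le_integrable _ _ _ _ _ _ _ (fun x => (f x ^+ 2 + g x ^+ 2)%:E)) => //.
- by apply/measurable_EFinP => /=; exact: measurable_funM.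
- move=> x _; rewrite lee_fin [leRHS]ger0_norm ?addr_ge0 ?sqr_ge0//.
  by rewrite ler_norml; nra.
- exact: (integrableD _ if2 ig2).
Qed.

Lemma sqintegrableD f g : sqintegrable f -> sqintegrable g ->
  sqintegrable (fun x => f x + g x).
Proof.
move=> sf sg; have ifg := sqintegrable_mul sf sg; move: sf sg => [mf if2] [mg ig2].
split; first exact: measurable_funD.
apply: eq_integrable (integrableD measurableT (integrableD measurableT if2 ig2)
  (integrableZl measurableT 2 ifg)) => // x _ /=.
by rewrite -!EFinD; congr (_%:E); ring.
Qed.

Lemma sqintegrableZ (a : R) f : sqintegrable f -> sqintegrable (fun x => a * f x).
Proof.
move=> [mf if2]; split; first exact: measurable_funM.
apply: eq_integrable (integrableZl measurableT (a ^+ 2) if2) => // x _ /=.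
by rewrite -!EFinM exprMn.
Qed.

Lemma sqintegrable_sum (I : Type) (r : seq I) (F : I -> T -> R) :
  (forall i, sqintegrable (F i)) -> sqintegrable (fun x => \sum_(i <- r) F i x).
Proof.
move=> sF; elim: r => [|i r IH].
  under eq_fun do rewrite big_nil; split; first exact: measurable_cst.
  under eq_fun do rewrite expr0n; exact: integrable0.
by under eq_fun do rewrite big_cons; exact: sqintegrableD.
Qed.

Lemma Rintegral_sum (I : Type) (r : seq I) (F : I -> T -> R) :
  (forall i, P.-integrable setT (EFin \o F i)) ->
  \int[P]_x (\sum_(i <- r) F i x) = \sum_(i <- r) \int[P]_x F i x.
Proof.
move=> iF; elim: r => [|i r IH].
  by under eq_Rintegral do rewrite big_nil; rewrite big_nil Rintegral_cst// mul0r.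
under eq_Rintegral do rewrite big_cons; rewrite big_cons RintegralD ?IH//.
rewrite (_ : _ \o _ = (fun x => \sum_(i <- r) (F i x)%:E)%E).
  by apply: integrable_sum => // j _; exact: iF.
by apply/funext => x /=; rewrite sumEFin.
Qed.

End square_integrable.

Section second_moment_matrix.
Context dT (T : measurableType dT) (R : realType) (P : probability T R) (d : nat).
Implicit Types f g : T -> 'cV[R]_d.

Definition sqintegrable_field f := forall i, sqintegrable P (fun x => f x i 0).

Definition second_moment f : 'M[R]_d :=
  \matrix_(i, j) \int[P]_x (f x i 0 * f x j 0).

Lemma sqintegrable_fieldD f g : sqintegrable_field f -> sqintegrable_field g ->
  sqintegrable_field (fun x => f x + g x).
Proof.
move=> sf sg i; under eq_fun do rewrite mxE; exact: sqintegrableD.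
Qed.

Lemma sqintegrable_dot f (v : 'cV[R]_d) : sqintegrable_field f ->
  sqintegrable P (fun x => (v^T *m f x) 0 0).
Proof.
move=> sf; under eq_fun do rewrite mxE.
by apply: sqintegrable_sum => i; apply: sqintegrableZ.
Qed.

Lemma second_moment_qform f (v : 'cV[R]_d) : sqintegrable_field f ->
  (v^T *m second_moment f *m v) 0 0 = \int[P]_x ((v^T *m f x) 0 0 ^+ 2).
Proof.
move=> sf.
have ivf i j : P.-integrable setT (EFin \o (fun x => v i 0 * (f x i 0 * f x j 0) * v j 0)).
  apply: eq_integrable (integrableZl measurableT (v i 0 * v j 0)
    (sqintegrable_mul (sf i) (sf j))) => //.
  by move=> x _ /=; rewrite -EFinM; congr (_%:E); ring.
transitivity (\int[P]_x (\sum_j \sum_i v i 0 * (f x i 0 * f x j 0) * v j 0)).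
  rewrite Rintegral_sum; last first.
    move=> j; rewrite (_ : _ \o _ = fun x => (\sum_i (v i 0 * (f x i 0 * f x j 0) * v j 0)%:E)%E).
      by apply: integrable_sum => // i _; exact: ivf.
    by apply/funext => x /=; rewrite sumEFin.
  rewrite mxE; apply: eq_bigr => j _; rewrite mxE mulr_suml.
  rewrite Rintegral_sum//; apply: eq_bigr => i _; rewrite !mxE.
  have iff := sqintegrable_mul (sf i) (sf j).
  rewrite RintegralZr// ?RintegralZl//.
  exact: (integrableZl measurableT (v i 0) iff).
apply: eq_Rintegral => x _; rewrite mxE expr2 big_distrlr/=.
rewrite exchange_big/=; apply: eq_bigr => i _; apply: eq_bigr => j _.
by rewrite !mxE; ring.
Qed.

Lemma psd_second_moment f : sqintegrable_field f -> psd (second_moment f).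
Proof.
move=> sf; split.
  apply/symmetricmxP/matrixP => i j; rewrite !mxE.
  by apply: eq_Rintegral => x _; rewrite mulrC.
by move=> v; rewrite second_moment_qform//; apply: Rintegral_ge0 => x _; exact: sqr_ge0.
Qed.

Lemma trace_second_moment f : sqintegrable_field f ->
  (\tr (second_moment f))%:E = (\int[P]_x (sqnorm (f x))%:E)%E.
Proof.
move=> sf; under eq_integral do rewrite /sqnorm -sumEFin.
rewrite integral_sum//; last by move=> i; have [] := sf i.
rewrite /mxtrace -sumEFin; apply: eq_bigr => i _; rewrite mxE.
under eq_Rintegral do rewrite -expr2.
by rewrite /Rintegral fineK//; apply: integrable_fin_num => //; have [] := sf i.
Qed.

(** Expectation of the pointwise identity
(1 + t) a^2 + (1 + 1/t) b^2 = (a + b)^2 + t (a - b / t)^2, in which a and b are the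
components of f and g along a fixed vector. *)
Lemma second_momentD_le f g (t : R) : 0 < t ->
  sqintegrable_field f -> sqintegrable_field g ->
  loewner (second_moment (fun x => f x + g x))
    ((1 + t) *: second_moment f + (1 + t^-1) *: second_moment g).
Proof.
move=> t0 sf sg; have sfg := sqintegrable_fieldD sf sg.
have [symf _] := psd_second_moment sf; have [symg _] := psd_second_moment sg.
have [symfg _] := psd_second_moment sfg.
split.
  rewrite -scaleN1r; apply: symmetricmxD; last exact: symmetricmxZ.
  by apply: symmetricmxD; exact: symmetricmxZ.
move=> v; rewrite mulmxBr mulmxBl mulmxDr mulmxDl -!scalemxAr -!scalemxAl.
have mxD (A B : 'M[R]_1) : (A + B) 0 0 = A 0 0 + B 0 0 by rewrite mxE.
have mxZ a (A : 'M[R]_1) : (a *: A) 0 0 = a * A 0 0 by rewrite mxE.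
have mxN (A : 'M[R]_1) : (- A) 0 0 = - A 0 0 by rewrite mxE.
rewrite !(mxD, mxZ, mxN) !second_moment_qform// subr_ge0.
have [_ i1] := sqintegrable_dot v sf; have [_ i2] := sqintegrable_dot v sg.
have [_ i3] := sqintegrable_dot v sfg.
have i1' := integrableZl measurableT (1 + t) i1.
have i2' := integrableZl measurableT (1 + t^-1) i2.
rewrite -RintegralZl// -RintegralZl// -RintegralD//.
apply: le_Rintegral => //; first exact: (integrableD measurableT i1' i2').
move=> x _; rewrite mulmxDr mxD.
set a := (v^T *m f x) 0 0; set b := (v^T *m g x) 0 0.
have -> : (1 + t) * a ^+ 2 + (1 + t^-1) * b ^+ 2 = (a + b) ^+ 2 + t * (a - t^-1 * b) ^+ 2.
  by field; rewrite gt_eqF.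
by rewrite lerDl mulr_ge0 ?sqr_ge0// ltW.
Qed.

(** For numbers r and s above the two square roots, the weight t = s / r gives
(1 + t) r^2 + (1 + 1/t) s^2 = (r + s)^2. *)
Lemma spectral_minkowski (gamma : 'M[R]_d -> R) f g :
  (exists N, norm_on_sym N /\ forall S, psd S -> gamma S = N S) ->
  (forall S S', psd S -> loewner S S' -> gamma S <= gamma S') ->
  sqintegrable_field f -> sqintegrable_field g ->
  Num.sqrt (gamma (second_moment (fun x => f x + g x))) <=
  Num.sqrt (gamma (second_moment f)) + Num.sqrt (gamma (second_moment g)).
Proof.
move=> [N [[N_ge0 _ NZ ND] gammaN]] gamma_mono sf sg.
have pf := psd_second_moment sf; have pg := psd_second_moment sg.
have gf : 0 <= gamma (second_moment f) by rewrite gammaN// N_ge0//; case: pf.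
have gg : 0 <= gamma (second_moment g) by rewrite gammaN// N_ge0//; case: pg.
apply/ler_addgt0Pl => e e0.
(* The slack e keeps r and s positive, so that s / r makes sense even when a
   second moment has norm zero. *)
pose r := Num.sqrt (gamma (second_moment f)) + e / 2.
pose s := Num.sqrt (gamma (second_moment g)) + e / 2.
have r0 : 0 < r by rewrite ltr_wpDl// ?sqrtr_ge0// divr_gt0.
have s0 : 0 < s by rewrite ltr_wpDl// ?sqrtr_ge0// divr_gt0.
have fr : gamma (second_moment f) <= r ^+ 2.
  by rewrite -[leLHS]sqr_sqrtr// lerXn2r ?nnegrE ?sqrtr_ge0 ?(ltW r0)// lerDl divr_ge0// ltW.
have gs : gamma (second_moment g) <= s ^+ 2.
  by rewrite -[leLHS]sqr_sqrtr// lerXn2r ?nnegrE ?sqrtr_ge0 ?(ltW s0)// lerDl divr_ge0// ltW.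
have t0 : 0 < s / r by rewrite divr_gt0.
have c1 : 0 <= 1 + s / r by rewrite addr_ge0// ltW.
have c2 : 0 <= 1 + (s / r)^-1 by rewrite addr_ge0// ltW// invr_gt0.
have -> : e + (Num.sqrt (gamma (second_moment f)) + Num.sqrt (gamma (second_moment g)))
  = r + s by rewrite /r /s; field.
have rs0 : 0 <= r + s by rewrite addr_ge0// ltW.
rewrite -[leRHS](ger0_norm rs0) -sqrtr_sqr ler_wsqrtr//.
apply: le_trans (gamma_mono _ _ (psd_second_moment (sqintegrable_fieldD sf sg))
  (second_momentD_le t0 sf sg)) _.
have [[symf _] [symg _]] := (pf, pg).
rewrite gammaN; last by apply: psdD; exact: psdZ.
apply: le_trans (ND _ _ (symmetricmxZ _ symf) (symmetricmxZ _ symg)) _.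
rewrite !NZ// !ger0_norm// -!gammaN//.
apply: le_trans (lerD (ler_wpM2l c1 fr) (ler_wpM2l c2 gs)) _.
rewrite le_eqVlt; apply/orP; left; apply/eqP; field.
by rewrite !gt_eqF.
Qed.

End second_moment_matrix.

(** * Couplings *)

Lemma measurable_preimage d1 d2 (T1 : measurableType d1) (T2 : measurableType d2)
    (f : T1 -> T2) A : measurable_fun setT f -> measurable A -> measurable (f @^-1` A).
Proof. by move=> mf mA; rewrite -[_ @^-1` _]setTI; exact: mf. Qed.

Section pushforward.
Context d1 d2 (T1 : measurableType d1) (T2 : measurableType d2) (R : realType).
Implicit Types (P : probability T1 R) (Q : probability T2 R) (X : T1 -> T2).

(** Probabilities are compared on measurable sets only, because their values on
other sets are arbitrary. *)
Definition has_law P X Q := forall A, measurable A -> P (X @^-1` A) = Q A.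

Lemma law_exists P X : measurable_fun setT X -> exists Q, has_law P X Q.
Proof.
move=> mX; pose X' : {mfun T1 >-> T2} := HB.pack X (isMeasurableFun.Build _ _ _ _ X mX).
by exists (distribution P X').
Qed.

Variables (P : probability T1 R) (X : T1 -> T2) (Q : probability T2 R).
Hypotheses (mX : measurable_fun setT X) (XQ : has_law P X Q).

Lemma law_ge0_integral (f : T2 -> \bar R) : measurable_fun setT f ->
  (forall y, (0 <= f y)%E) -> (\int[P]_x f (X x) = \int[Q]_y f y)%E.
Proof.
move=> mf f0.
have h := ge0_integral_pushforward mX P measurableT mf (fun y _ => f0 y).
transitivity (\int[pushforward P X]_y f y)%E; first by rewrite h preimage_setT.
by apply: eq_measure_integral => A mA _; exact: XQ.
Qed.

Lemma law_integrable (f : T2 -> R) : Q.-integrable setT (EFin \o f) ->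
  P.-integrable setT (EFin \o (f \o X)).
Proof.
move=> /integrableP[mf fi]; apply/integrableP; split.
  exact: measurableT_comp mf mX.
apply: le_lt_trans fi; rewrite -law_ge0_integral//.
exact: measurableT_comp.
Qed.

Lemma law_Rintegral (f : T2 -> R) : Q.-integrable setT (EFin \o f) ->
  \int[P]_x f (X x) = \int[Q]_y f y.
Proof.
move=> fi; congr fine; have /integrableP[mf _] := fi.
rewrite [LHS]integralE [RHS]integralE.
congr (_ - _)%E.
  rewrite -(law_ge0_integral (measurable_funepos mf))//.
  by apply: eq_integral => x _; rewrite /= !funeposE.
rewrite -(law_ge0_integral (measurable_funeneg mf))//.
by apply: eq_integral => x _; rewrite /= !funenegE.
Qed.

Lemma law_sqintegrable (f : T2 -> R) : sqintegrable Q f -> sqintegrable P (f \o X).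
Proof.
move=> [mf if2]; split; first exact: measurableT_comp.
exact: (@law_integrable (fun y => f y ^+ 2)).
Qed.

Lemma law_second_moment d (f : T2 -> 'cV[R]_d) : sqintegrable_field Q f ->
  second_moment P (f \o X) = second_moment Q f.
Proof.
move=> sf; apply/matrixP => i j; rewrite !mxE.
apply: (@law_Rintegral (fun y => f y i 0 * f y j 0)).
exact: sqintegrable_mul (sf i) (sf j).
Qed.

End pushforward.

Section product_laws.
Context d1 d2 (T1 : measurableType d1) (T2 : measurableType d2) (R : realType).
Variables (P : probability T1 R) (Q : probability T2 R).

Lemma product_law_fst : has_law (P \x Q)%E fst P.
Proof.
move=> A mA; rewrite (_ : fst @^-1` A = A `*` setT); last first.
  by apply/seteqP; split; case=> x y // [].
transitivity (P A * Q setT)%E; first exact: product_measure1E.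
by rewrite probability_setT mule1.
Qed.

Lemma product_law_snd : has_law (P \x Q)%E snd Q.
Proof.
move=> A mA; rewrite (_ : snd @^-1` A = setT `*` A); last first.
  by apply/seteqP; split; case=> x y // [].
transitivity (P setT * Q A)%E; first exact: product_measure1E.
by rewrite probability_setT mul1e.
Qed.

End product_laws.

Section couplings.
Variables (R : realType) (d : nat).
Local Notation RdT := (Rd R d).
Local Notation P2T := (P2 R d).
Implicit Types (mu nu : P2T) (pi : probability (RdT * RdT)%type R).

Lemma measurable_coord i : measurable_fun [set: RdT] (fun x : RdT => (x : 'cV[R]_d) i 0).
Proof.
apply: (measurability _ (RGenOInfty.measurableE R)) => _ [_ [a ->] <-].
rewrite setTI; apply: sub_sigma_algebra.
apply: (@open_comp _ _ (fun x : 'cV[R]_d => x i 0)).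
  by move=> x _; exact: coord_continuous.
exact: interval_open.
Qed.

Lemma coord_sqintegrable mu i : sqintegrable mu (fun x : RdT => (x : 'cV[R]_d) i 0).
Proof.
split; first exact: measurable_coord.
apply/integrableP; split.
  by apply/measurable_EFinP; apply: measurable_funX; exact: measurable_coord.
apply: le_lt_trans (P2_moment mu); apply: ge0_le_integral => //.
- apply/measurable_EFinP; apply: measurableT_comp => //.
  by apply: measurable_funX; exact: measurable_coord.
- apply/measurable_EFinP; apply: measurable_sum => j.
  by apply: measurable_funX; exact: measurable_coord.
- move=> x _; rewrite abse_EFin lee_fin ger0_norm ?sqr_ge0//.
  by rewrite /sqnorm (bigD1 i)//= lerDl sumr_ge0// => j _; exact: sqr_ge0.
Qed.

Lemma couplingsP (mu nu : probability RdT R) pi :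
  couplings mu nu pi <-> has_law pi fst mu /\ has_law pi snd nu.
Proof.
have f1 (A : set RdT) : fst @^-1` A = A `*` [set: RdT].
  by apply/seteqP; split; case=> x y // [].
have f2 (A : set RdT) : snd @^-1` A = [set: RdT] `*` A.
  by apply/seteqP; split; case=> x y // [].
split=> -[h1 h2]; split=> A mA;
  [rewrite f1 h1//|rewrite f2 h2//|rewrite -f1 h1//|rewrite -f2 h2//].
Qed.

Lemma displacement_mxE pi : displacement_mx pi = second_moment pi (@displacement R d).
Proof.
apply/matrixP => i j; rewrite !mxE; apply: eq_Rintegral => z _.
by rewrite mxE big_ord1 [_^T _ _]mxE.
Qed.

Lemma displacement_sqintegrable mu nu pi : couplings mu nu pi ->
  sqintegrable_field pi (@displacement R d).
Proof.
move=> /couplingsP[p1 p2] i.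
have h1 := law_sqintegrable measurable_fst p1 (coord_sqintegrable mu i).
have h2 := law_sqintegrable measurable_snd p2 (coord_sqintegrable nu i).
have := sqintegrableD h2 (sqintegrableZ (-1) h1).
by congr sqintegrable; apply/funext => z; rewrite /displacement !mxE/= mulN1r.
Qed.

Lemma psd_displacement_mx mu nu pi : couplings mu nu pi -> psd (displacement_mx pi).
Proof.
by move=> c; rewrite displacement_mxE; exact/psd_second_moment/displacement_sqintegrable/c.
Qed.

Lemma couplings_neq0 mu nu : couplings mu nu !=set0.
Proof.
exists (mu \x nu)%E; apply/couplingsP.
by split; [exact: product_law_fst|exact: product_law_snd].
Qed.

Lemma couplings_swap mu nu pi : couplings mu nu pi ->
  exists2 pi', couplings nu mu pi' & displacement_mx pi' = displacement_mx pi.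
Proof.
move=> c; have [pi' sw] := law_exists pi (@measurable_swap _ _ RdT RdT).
have /couplingsP[c1 c2] := c.
have c' : couplings nu mu pi'.
  apply/couplingsP; split=> A mA.
    rewrite -sw; [exact: c2|by apply: measurable_preimage].
  by rewrite -sw; [exact: c1|by apply: measurable_preimage].
exists pi' => //.
rewrite !displacement_mxE -(law_second_moment (@measurable_swap _ _ _ _) sw); last first.
  exact: displacement_sqintegrable c'.
apply/matrixP => i j; rewrite !mxE; apply: eq_Rintegral => z _.
by rewrite /displacement/= !mxE; ring.
Qed.

Lemma couplings_diag mu nu : same_measure mu nu ->
  exists2 pi, couplings mu nu pi & displacement_mx pi = 0.
Proof.
move=> mn.
have mdiag : measurable_fun setT (fun x : RdT => (x, x)) by exact: measurable_fun_pair.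
have [pi diag] := law_exists (P2_prob mu) mdiag.
have c : couplings mu nu pi.
  apply/couplingsP; split=> A mA.
    by rewrite -diag//; by apply: measurable_preimage.
  rewrite -diag; [exact: mn|by apply: measurable_preimage].
exists pi => //.
rewrite displacement_mxE -(law_second_moment mdiag diag); last first.
  exact: displacement_sqintegrable c.
apply/matrixP => i j; rewrite !mxE.
under eq_Rintegral do rewrite /displacement/= subrr mxE mul0r.
by rewrite Rintegral_cst// mul0r.
Qed.

End couplings.

(** * Gluing couplings along a grid *)

Lemma measure_fibers d (T : measurableType d) (R : realType)
    (P : {measure set T -> \bar R}) (c : T -> nat) (A : set T) :
  (forall k, measurable (c @^-1` [set k])) -> measurable A ->
  (\sum_(0 <= k <oo) P (A `&` c @^-1` [set k]) = P A)%E.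
Proof.
move=> mc mA.
have mAc k : measurable (A `&` c @^-1` [set k]) by exact: measurableI.
have UE : \bigcup_k (A `&` c @^-1` [set k]) = A.
  apply/seteqP; split=> [x [k _ []]//|x Ax].
  by exists (c x).
rewrite -[RHS](congr1 P UE) measure_semi_bigcup//.
  by apply: trivIset_setIl; exact: trivIset_preimage1.
exact: bigcup_measurable.
Qed.

Section discrete_gluing.
Context d1 d2 (T1 : measurableType d1) (T2 : measurableType d2) (R : realType).
Variables (P1 : probability T1 R) (P2 : probability T2 R).
Variables (c1 : T1 -> nat) (c2 : T2 -> nat).
Hypothesis mc1 : forall k, measurable (c1 @^-1` [set k]).
Hypothesis mc2 : forall k, measurable (c2 @^-1` [set k]).
Hypothesis c12 : forall k, P1 (c1 @^-1` [set k]) = P2 (c2 @^-1` [set k]).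

Let C1 k := c1 @^-1` [set k].
Let C2 k := c2 @^-1` [set k].

Let w k : R := fine (P1 (C1 k)).

Let w_ge0 k : 0 <= (w k)^-1.
Proof. by rewrite invr_ge0 fine_ge0. Qed.

Let mE k : measurable (C1 k `*` C2 k).
Proof. by apply: measurableX; [exact: mc1|exact: mc2]. Qed.

(* The part of the glued measure carried by cell k: the product measure
   restricted to that cell, normalised by the mass of the cell. *)
Let m k := mscale (NngNum (w_ge0 k)) (mrestr (P1 \x P2)%E (mE k)).

Let glue : {measure set (T1 * T2) -> \bar R} := mseries m 0.

Let glue_rect A B : measurable A -> measurable B ->
  glue (A `*` B) =
  (\sum_(0 <= k <oo) ((w k)^-1%:E * (P1 (A `&` C1 k) * P2 (B `&` C2 k))))%E.
Proof.
move=> mA mB; apply: eq_eseriesr => k _.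
rewrite /m /mscale /mrestr /=; congr (_ * _)%E.
rewrite -[LHS]/((P1 \x P2)%E _) -setXI.
by apply: product_measure1E; apply: measurableI => //; [exact: mc1|exact: mc2].
Qed.

Let cancel_weight (a b : \bar R) k : (0 <= a <= b)%E -> b = (w k)%:E ->
  ((w k)^-1%:E * (a * b) = a)%E.
Proof.
move=> /andP[a0 ab] bw; rewrite bw in ab *.
move: a a0 ab => [a| |]; rewrite ?leNye_eq ?leye_eq//= !lee_fin => a0 aw.
rewrite -!EFinM; congr (_%:E).
(* Cells of mass zero get weight 0^-1 = 0, and carry no mass to be missed. *)
have [w0|w0] := eqVneq (w k) 0; last by rewrite mulrCA mulVf// mulr1.
by rewrite w0 mulr0 mulr0; apply/eqP; rewrite eq_le a0 -w0 aw.
Qed.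

Let wE k : P1 (C1 k) = (w k)%:E.
Proof. by rewrite /w fineK//; apply: fin_num_measure; exact: mc1. Qed.

Let glue_fst A : measurable A -> glue (A `*` setT) = P1 A.
Proof.
move=> mA; rewrite glue_rect// -(measure_fibers P1 mc1 mA); apply: eq_eseriesr => k _.
rewrite setTI; apply: cancel_weight; last by rewrite -c12 wE.
by rewrite measure_ge0 -c12 measureIr//; exact: mc1.
Qed.

Let glue_snd A : measurable A -> glue (setT `*` A) = P2 A.
Proof.
move=> mA; rewrite glue_rect// -(measure_fibers P2 mc2 mA); apply: eq_eseriesr => k _.
rewrite setTI [X in (_ * X)%E]muleC; apply: cancel_weight; last by rewrite wE.
by rewrite measure_ge0 (c12 k : P1 (C1 k) = P2 (C2 k)) measureIr//; exact: mc2.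
Qed.

Let glue_setT : glue setT = 1%E.
Proof. by rewrite -setXTT glue_fst// probability_setT. Qed.

(** The two components are made independent conditionally on their common index,
which requires no disintegration because the index takes countably many values. *)
Lemma discrete_gluing : exists Pi : probability (T1 * T2)%type R,
  [/\ has_law Pi fst P1, has_law Pi snd P2 &
      \forall z \ae Pi, c1 z.1 = c2 z.2].
Proof.
pose Pi : probability (T1 * T2)%type R :=
  HB.pack (Measure.sort glue) (Measure_isProbability.Build _ _ _ glue glue_setT).
exists Pi; split.
- move=> A mA; rewrite (_ : fst @^-1` A = A `*` setT); last first.
    by apply/seteqP; split; case=> x y // [].
  exact: glue_fst.
- move=> A mA; rewrite (_ : snd @^-1` A = setT `*` A); last first.
    by apply/seteqP; split; case=> x y // [].
  exact: glue_snd.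
exists (~` (\bigcup_k (C1 k `*` C2 k))); split.
- by apply: measurableC; exact: bigcup_measurable.
- apply: eseries0 => k _ _.
  pose N := ~` (\bigcup_j (C1 j `*` C2 j)) `&` (C1 k `*` C2 k).
  transitivity ((w k)^-1%:E * (P1 \x P2)%E N)%E; first by [].
  suff -> : N = set0 by rewrite measure0 mule0.
  by apply/seteqP; split => // z [nz Ez]; apply: nz; exists k.
- by move=> z /= nz [k _ [/= h1 h2]]; apply: nz; rewrite h1 h2.
Qed.

End discrete_gluing.

Section grid_cells.
Variables (R : realType) (d : nat) (e : R).
Hypothesis e_gt0 : 0 < e.

Definition grid_cell (x : 'cV[R]_d) : nat :=
  pickle (\col_(i < d) Num.floor (x i 0 / e)).

Lemma grid_cell_close x y : grid_cell x = grid_cell y ->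
  forall i, `|x i 0 - y i 0| <= e.
Proof.
move=> /(pcan_inj pickleK) /colP xy i; have := xy i; rewrite !mxE => xyi.
have /andP[x1 x2] := floor_itv (x i 0 / e).
have /andP[y1 y2] := floor_itv (y i 0 / e).
move: x1 x2 y1 y2; rewrite -xyi ler_pdivlMr// ltr_pdivrMr// ler_pdivlMr// ltr_pdivrMr//.
rewrite intrD mulrDl mul1r => x1 x2 y1 y2.
by rewrite ler_norml; apply/andP; split; lra.
Qed.

Lemma measurable_grid_cell k : measurable (grid_cell @^-1` [set k] : set (Rd R d)).
Proof.
have floorE (y : R) (m : int) :
    Num.floor (y / e) = m <-> y \in `[m%:~R * e, (m + 1)%:~R * e[.
  rewrite in_itv/= -ler_pdivlMr// -ltr_pdivrMr//.
  by split=> [<-|]; [exact: floor_itv|exact: floor_def].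
have [[v vk]|nok] := pselect (exists v : 'cV[int]_d, pickle v = k); last first.
  rewrite [X in measurable X](_ : _ = set0)//.
  by apply/seteqP; split => // x /= xk; apply: nok; eexists; exact: xk.
rewrite [X in measurable X](_ : _ =
    \bigcap_(i in [set: 'I_d]) [set x : Rd R d |
      (x : 'cV[R]_d) i 0 \in `[(v i 0)%:~R * e, (v i 0 + 1)%:~R * e[]); last first.
  apply/seteqP; split => [x xk i _ /=|x xv /=].
    have /colP/(_ i) : \col_(i < d) Num.floor ((x : 'cV[R]_d) i 0 / e) = v.
      by apply: (pcan_inj pickleK); rewrite vk.
    by rewrite mxE => /floorE.
  by rewrite -vk; congr pickle; apply/colP => i; rewrite mxE; apply/floorE/xv.
apply: fin_bigcap_measurable; first exact: finite_finset.
move=> i _; rewrite -[X in measurable X]setTI.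
exact: (measurable_coord i measurableT (measurable_itv _)).
Qed.

End grid_cells.

Section gluing_couplings.
Variables (R : realType) (d : nat).
Local Notation RdT := (Rd R d).
Local Notation P2T := (P2 R d).
Variable gamma : 'M[R]_d -> R.
Hypothesis gamma_norm : exists N : 'M[R]_d -> R,
     norm_on_sym N /\ forall S : 'M[R]_d, psd S -> gamma S = N S.
Hypothesis gamma_mono : forall S S' : 'M[R]_d,
     psd S -> loewner S S' -> gamma S <= gamma S'.

Lemma trace_second_moment_le dT (T : measurableType dT) (P : probability T R)
    (g : T -> 'cV[R]_d) (e : R) : sqintegrable_field P g ->
  (\forall x \ae P, forall i, `|g x i 0| <= e) ->
  \tr (second_moment P g) <= d%:R * e ^+ 2.
Proof.
move=> sg ge; rewrite mulr_natl -[X in _ *+ X]card_ord -sumr_const.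
apply: ler_sum => i _; rewrite mxE.
have [mg ig] := sg i.
have h : (\int[P]_x (g x i 0 ^+ 2)%:E <= (e ^+ 2)%:E)%E.
  have <- : (\int[P]_x (e ^+ 2)%:E = (e ^+ 2)%:E)%E.
    by rewrite integral_cst//= probability_setT mule1.
  apply: ae_ge0_le_integral => //.
  - by move=> x _; rewrite lee_fin sqr_ge0.
  - by have /integrableP[] := ig.
  - by move=> x _; rewrite lee_fin sqr_ge0.
  apply: filterS ge => x gx _; rewrite lee_fin -real_normK ?num_real//.
  have e0 : 0 <= e by exact: le_trans (normr_ge0 _) (gx i).
  by rewrite lerXn2r.
under eq_Rintegral do rewrite -expr2.
by rewrite -lee_fin /Rintegral fineK//; exact: integrable_fin_num ig.
Qed.

(** The gluing replaces the middle point y by two points y, y' of a common cell of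
side [eta]; the error y' - y contributes O(eta) to the square root of the cost. *)
Lemma couplings_compose (mu nu rho : P2T) pi1 pi2 : couplings mu nu pi1 ->
  couplings nu rho pi2 -> forall e, 0 < e ->
  exists2 pi, couplings mu rho pi &
  Num.sqrt (gamma (displacement_mx pi)) <=
  Num.sqrt (gamma (displacement_mx pi1)) + Num.sqrt (gamma (displacement_mx pi2)) + e.
Proof.
have [N [normN gammaN]] := gamma_norm.
have [c [C [c0 C0 cC]]] := norm_on_sym_trace_equiv normN.
move=> cpl1 cpl2 e e0.
(* Any eta with C d eta^2 <= e^2 will do; this one avoids a square root. *)
pose eta := e / (1 + C * d%:R).
have D0 : 0 < 1 + C * d%:R by rewrite ltr_pwDl// mulr_ge0// ltW.
have eta0 : 0 < eta by rewrite divr_gt0.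
have /couplingsP[l11 l12] := cpl1; have /couplingsP[l21 l22] := cpl2.
have mcell := @measurable_grid_cell R d eta eta0.
have [||k|Pi [L1 L2 cell]] := @discrete_gluing _ _ _ _ _ pi1 pi2
  (fun z => grid_cell eta (z.2 : 'cV[R]_d)) (fun z => grid_cell eta (z.1 : 'cV[R]_d)).
- by move=> k; exact: (@measurable_preimage _ _ (RdT * RdT)%type RdT snd _ measurable_snd (mcell k)).
- by move=> k; exact: (@measurable_preimage _ _ (RdT * RdT)%type RdT fst _ measurable_fst (mcell k)).
- by rewrite (l12 _ (mcell k)) (l21 _ (mcell k)).
pose X (z : (RdT * RdT) * (RdT * RdT)) : RdT * RdT := (z.1.1, z.2.2).
have mX : measurable_fun setT X.
  by apply: measurable_fun_pair; apply: measurableT_comp.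
have [pi LX] := law_exists Pi mX.
have cpl : couplings mu rho pi.
  apply/couplingsP; split => A mA.
    rewrite -LX; last by apply: measurable_preimage.
    rewrite -l11// -L1//; by apply: measurable_preimage.
  rewrite -LX; last by apply: measurable_preimage.
  rewrite -l22// -L2//; by apply: measurable_preimage.
exists pi => //.
pose h1 (z : (RdT * RdT) * (RdT * RdT)) : 'cV[R]_d := displacement z.1.
pose h2 (z : (RdT * RdT) * (RdT * RdT)) : 'cV[R]_d := displacement z.2.
pose g (z : (RdT * RdT) * (RdT * RdT)) : 'cV[R]_d :=
  (z.2.1 : 'cV[R]_d) - (z.1.2 : 'cV[R]_d).
have s1 : sqintegrable_field Pi h1.
  by move=> i; exact: (law_sqintegrable measurable_fst L1 (displacement_sqintegrable cpl1 i)).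
have s2 : sqintegrable_field Pi h2.
  by move=> i; exact: (law_sqintegrable measurable_snd L2 (displacement_sqintegrable cpl2 i)).
have sg : sqintegrable_field Pi g.
  move=> i.
  have q1 := law_sqintegrable measurable_fst L1
    (law_sqintegrable measurable_snd l12 (coord_sqintegrable nu i)).
  have q2 := law_sqintegrable measurable_snd L2
    (law_sqintegrable measurable_fst l21 (coord_sqintegrable nu i)).
  have := sqintegrableD q2 (sqintegrableZ (-1) q1).
  by congr sqintegrable; apply/funext => z; rewrite /g !mxE/= mulN1r.
have -> : displacement_mx pi = second_moment Pi (fun z => h1 z + h2 z + g z).
  rewrite displacement_mxE -(law_second_moment mX LX); last first.
    exact: displacement_sqintegrable cpl.
  congr second_moment; apply/funext => z.
  by apply/colP => i; rewrite /h1 /h2 /g /displacement /= !mxE; ring.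
apply: le_trans (spectral_minkowski gamma_norm gamma_mono (sqintegrable_fieldD s1 s2) sg) _.
apply: lerD.
  apply: le_trans (spectral_minkowski gamma_norm gamma_mono s1 s2) _.
  rewrite !displacement_mxE -(law_second_moment measurable_fst L1); last first.
    exact: displacement_sqintegrable cpl1.
  by rewrite -(law_second_moment measurable_snd L2)//; exact: displacement_sqintegrable cpl2.
rewrite -[leRHS]ger0_norm ?(ltW e0)// -sqrtr_sqr ler_wsqrtr//.
rewrite gammaN; last exact: psd_second_moment.
have /andP[_] := cC _ (psd_second_moment sg); move=> /le_trans; apply.
have tr_le : \tr (second_moment Pi g) <= d%:R * eta ^+ 2.
  apply: trace_second_moment_le => //; apply: filterS cell => z /= /grid_cell_close ge i.
  by have := ge eta0 i; rewrite !mxE distrC.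
apply: le_trans (ler_wpM2l (ltW C0) tr_le) _.
rewrite /eta expr_div_n mulrA mulrA ler_pdivrMr ?exprn_gt0//.
rewrite mulrC ler_wpM2l ?sqr_ge0//.
have : 0 <= C * d%:R by rewrite mulr_ge0// ltW.
by move: (C * d%:R) => x x0; nra.
Qed.

End gluing_couplings.

(** * Separation *)

Section separation.
Variables (R : realType) (d : nat).
Local Notation RdT := (Rd R d).
Local Notation P2T := (P2 R d).

(* Points whose distance to the complement of U is at least 1 / (n + 1). *)
Let inner (U : set 'cV[R]_d) (n : nat) : set 'cV[R]_d :=
  [set x | ball x n.+1%:R^-1 `<=` U].

(* The complement is a union of balls, hence open. *)
Let measurable_inner U n : measurable (inner U n : set RdT).
Proof.
rewrite -(setCK (inner U n)); apply: measurableC; apply: sub_sigma_algebra.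
rewrite [X in open X](_ : _ = \bigcup_(y in ~` U) ball y n.+1%:R^-1).
  by apply: bigcup_open => y _; exact: ball_open.
apply/seteqP; split => [x /= /existsNP[y /not_implyP[xy Uy]]|x [y Uy yx] xU].
  by exists y => //; exact: ball_sym.
by apply: Uy; apply: xU; exact: ball_sym.
Qed.

Let bigcup_inner U : open U -> \bigcup_n inner U n = U.
Proof.
move=> oU; apply/seteqP; split => [x [n _ xU]|x Ux].
  by apply: xU; exact: ballxx.
have /nbhs_ballP[r /= r0 xr] := open_nbhs_nbhs (conj oU Ux).
have [n _ /(_ _ (leqnn n)) nr] := near_infty_natSinv_lt (PosNum r0).
by exists n => //; apply: subset_trans xr; apply: le_ball; exact: ltW.
Qed.

Let inner_homo U : nondecreasing_seq (inner U).
Proof.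
move=> n m nm; apply/subsetPset => x /= xU; apply: subset_trans xU.
by apply: le_ball; rewrite lef_pV2 ?posrE// ler_nat.
Qed.

Lemma measurable_sqnorm_displacement :
  measurable_fun [set: RdT * RdT] (fun z => sqnorm (displacement z)).
Proof.
apply: measurable_sum => i; apply: measurable_funX.
under eq_fun do rewrite /displacement !mxE/=.
by apply: measurable_funB; apply: (measurableT_comp (measurable_coord i)).
Qed.

(** A pair (x, y) with x in [inner U n] and y outside U is displaced by at least
1 / (n + 1); Markov's inequality bounds the probability of that. *)
Lemma coupling_inner_le (mu nu : P2T) pi (U : set 'cV[R]_d) n :
  couplings mu nu pi -> open U ->
  (mu (inner U n : set RdT) <= nu (U : set RdT) +
    (n.+1%:R ^+ 2 * \tr (displacement_mx pi))%:E)%E.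
Proof.
move=> c oU; have /couplingsP[c1 c2] := c.
have mU : measurable (U : set RdT) by exact: sub_sigma_algebra.
have mI := measurable_inner U n.
pose r : R := n.+1%:R^-1.
have r0 : 0 < r by rewrite invr_gt0.
pose g (z : RdT * RdT) : \bar R := (sqnorm (displacement z))%:E.
have mg : measurable_fun setT g.
  by apply/measurable_EFinP; exact: measurable_sqnorm_displacement.
pose B := setT `&` [set z | ((r ^+ 2)%:E <= `|g z|)%E].
have mB : measurable B.
  by apply: emeasurable_fun_c_infty => //; exact: measurableT_comp.
have markov : (pi B <= (n.+1%:R ^+ 2 * \tr (displacement_mx pi))%:E)%E.
  have intg : (\int[pi]_z `|g z| = (\tr (displacement_mx pi))%:E)%E.
    rewrite displacement_mxE (trace_second_moment (displacement_sqintegrable c)).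
    apply: eq_integral => z _; rewrite gee0_abs// lee_fin.
    by rewrite sumr_ge0// => i _; exact: sqr_ge0.
  have : ((r ^+ 2)%:E * pi B <= \int[pi]_z `|g z|)%E.
    by have -> := le_integral_abse pi measurableT mg (exprn_gt0 2 r0).
  rewrite intg.
  have -> : pi B = (fine (pi B))%:E by rewrite fineK//; exact: fin_num_measure.
  rewrite -EFinM !lee_fin.
  by rewrite /r exprVn -ler_pdivlMl ?invr_gt0 ?exprn_gt0// invrK.
rewrite -c1// -c2//.
have mfI : measurable (fst @^-1` (inner U n : set RdT) : set (RdT * RdT)).
  exact: (@measurable_preimage _ _ (RdT * RdT)%type RdT fst _ measurable_fst mI).
have msU : measurable (snd @^-1` (U : set RdT) : set (RdT * RdT)).
  exact: (@measurable_preimage _ _ (RdT * RdT)%type RdT snd _ measurable_snd mU).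
apply: (@le_trans _ _ (pi (snd @^-1` (U : set RdT) `|` B))).
  apply: le_measure; rewrite ?inE//; first exact: measurableU.
  move=> [x y] /= xU; have [Uy|nUy] := pselect (U y); [by left|right; split => //=].
  have /existsNP[i xyi] : ~ forall i, ball (x i 0) r ((y : 'cV[R]_d) i 0).
    move=> xy; apply: nUy; apply: xU; split => // i j.
    by rewrite ord1; exact: xy.
  rewrite lee_fin ger0_norm; last by rewrite sumr_ge0// => j _; exact: sqr_ge0.
  rewrite /sqnorm (bigD1 i)//= -[leLHS]addr0 lerD//; last first.
    by rewrite sumr_ge0// => j _; exact: sqr_ge0.
  rewrite -[leRHS]real_normK ?num_real// lerXn2r ?nnegrE ?(ltW r0)//.
  rewrite /displacement !mxE/= distrC leNgt; apply/negP => h; apply: xyi.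
  exact: h.
apply: le_trans (measureU2 _ _ _) _ => //.
by rewrite leeD2l.
Qed.

Lemma couplings_null_le (mu nu : P2T) :
  (forall e, 0 < e -> exists2 pi, couplings mu nu pi & \tr (displacement_mx pi) < e) ->
  forall U : set 'cV[R]_d, open U -> (mu (U : set RdT) <= nu (U : set RdT))%E.
Proof.
move=> small U oU.
have mU : measurable (U : set RdT) by exact: sub_sigma_algebra.
have muin n : (mu (inner U n : set RdT) <= nu (U : set RdT))%E.
  apply/lee_addgt0Pr => e e0.
  have [|pi c pie] := small (e / n.+1%:R ^+ 2); first by rewrite divr_gt0// exprn_gt0.
  apply: le_trans (coupling_inner_le n c oU) _; rewrite leeD2l// lee_fin.
  by rewrite mulrC -ler_pdivlMr ?exprn_gt0// ltW.
have bU : \bigcup_n (inner U n : set RdT) = U by exact: bigcup_inner.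
have := @nondecreasing_cvg_mu _ RdT R mu (inner U) (measurable_inner U).
rewrite bU => /(_ mU (@inner_homo U)) h.
rewrite -(cvg_lim _ h)//; apply: lime_le; first by apply/cvg_ex; eexists; exact: h.
exact: nearW.
Qed.

(** Swapping the couplings turns the inequality on open sets into an equality, and
open sets form a pi-system that generates the Borel sets. *)
Lemma couplings_null_same_measure (mu nu : P2T) :
  (forall e, 0 < e -> exists2 pi, couplings mu nu pi & \tr (displacement_mx pi) < e) ->
  same_measure mu nu.
Proof.
move=> small A mA.
have small' e : 0 < e -> exists2 pi, couplings nu mu pi & \tr (displacement_mx pi) < e.
  by move=> /small[pi /couplings_swap[pi' c' <-] pie]; exists pi'.
have munu (U : set 'cV[R]_d) : open U -> mu (U : set RdT) = nu (U : set RdT).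
  by move=> oU; apply/eqP; rewrite eq_le; apply/andP; split; apply: couplings_null_le.
apply: (@measure_unique _ R RdT (@open 'cV[R]_d) (fun=> setT) erefl) => //.
- exact: openI.
- by move=> _; exact: openT.
- by rewrite bigcup_const.
- move=> _; apply: (@le_lt_trans _ _ 1%E); last exact: ltry.
  exact: probability_le1 (P2_prob mu) _ measurableT.
Qed.

End separation.

(** * The spectral cost and its comparison with the trace *)

Section spectral_cost.
Variables (R : realType) (d : nat) (gamma : 'M[R]_d -> R).
Hypothesis gamma_ge0 : forall S, psd S -> 0 <= gamma S.
Implicit Types (mu nu : P2 R d).

Let lbound_costs mu nu :
  lbound [set gamma (displacement_mx pi) | pi in couplings mu nu] 0.
Proof. by move=> _ [pi /psd_displacement_mx psdM <-]; exact: gamma_ge0. Qed.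

Let costs_neq0 mu nu :
  [set gamma (displacement_mx pi) | pi in couplings mu nu] !=set0.
Proof. by have [pi c] := couplings_neq0 mu nu; exists (gamma (displacement_mx pi)), pi. Qed.

Lemma spectral_W_le mu nu pi : couplings mu nu pi ->
  spectral_W gamma mu nu <= Num.sqrt (gamma (displacement_mx pi)).
Proof.
move=> c; apply: ler_wsqrtr; apply: ge_inf; last by exists pi.
by exists 0; exact: lbound_costs.
Qed.

Lemma spectral_W_approx mu nu e : 0 < e ->
  exists2 pi, couplings mu nu pi &
    Num.sqrt (gamma (displacement_mx pi)) < spectral_W gamma mu nu + e.
Proof.
move=> e0; set W := spectral_W gamma mu nu.
have W0 : 0 <= W by exact: sqrtr_ge0.
set E := [set gamma (displacement_mx pi) | pi in couplings mu nu].
have infE : inf E = W ^+ 2.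
  by rewrite sqr_sqrtr//; apply: lb_le_inf; [exact: costs_neq0|exact: lbound_costs].
have hE : has_inf E by split; [exact: costs_neq0|exists 0; exact: lbound_costs].
have d0 : 0 < (W + e) ^+ 2 - inf E.
  by rewrite infE subr_gt0 ltrXn2r// ?ltrDl// nnegrE addr_ge0// ltW.
have [_ [pi c <-] h] := inf_adherent d0 hE.
exists pi => //.
have We : 0 <= W + e by rewrite addr_ge0// ltW.
rewrite -(ger0_norm We) -sqrtr_sqr ltr_sqrt ?exprn_gt0 ?ltr_wpDl//.
by move: h; rewrite addrC subrK.
Qed.

End spectral_cost.

Section comparison.
Variables (R : realType) (d : nat).
Implicit Types (gamma : 'M[R]_d -> R) (mu nu : P2 R d).

Lemma spectral_W_compare gamma1 gamma2 C :
  (forall S, psd S -> 0 <= gamma1 S) -> (forall S, psd S -> 0 <= gamma2 S) ->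
  0 < C -> (forall S, psd S -> gamma1 S <= C * gamma2 S) ->
  forall mu nu, spectral_W gamma1 mu nu <= Num.sqrt C * spectral_W gamma2 mu nu.
Proof.
move=> g1 g2 C0 g12 mu nu.
have sC : 0 < Num.sqrt C by rewrite sqrtr_gt0.
rewrite -ler_pdivrMl//; apply/ler_addgt0Pr => e e0.
have [pi c h] := spectral_W_approx g2 mu nu e0.
rewrite ler_pdivrMl//; apply: le_trans (spectral_W_le g1 c) _.
apply: le_trans (ler_wpM2l (ltW sC) (ltW h)).
by rewrite -sqrtrM ?(ltW C0)// ler_wsqrtr// g12//; exact: psd_displacement_mx c.
Qed.

(** [W2] takes its infimum in the extended reals and [spectral_W] in the reals;
they agree because all these costs are finite. *)
Lemma W2E mu nu : W2 mu nu = spectral_W (@mxtrace R d) mu nu.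
Proof.
rewrite /W2 /spectral_W; congr (Num.sqrt _).
rewrite (_ : image _ _ = EFin @` [set \tr (displacement_mx pi) | pi in couplings mu nu]).
  rewrite ereal_inf_EFin//.
    by exists 0 => _ [pi /psd_displacement_mx psdM <-]; exact: mxtrace_psd_ge0.
  by have [pi c] := couplings_neq0 mu nu; exists (\tr (displacement_mx pi)), pi.
have trE pi : couplings mu nu pi ->
    (\int[pi]_z (sqnorm (displacement z))%:E)%E = (\tr (displacement_mx pi))%:E.
  by move=> c; rewrite displacement_mxE trace_second_moment//; exact: displacement_sqintegrable c.
apply/seteqP; split => [_ [pi c <-]|_ [_ [pi c <-] <-]].
  by exists (\tr (displacement_mx pi)); [exists pi|rewrite trE].
by exists pi => //; rewrite trE.
Qed.

End comparison.

Lemma induced_topology_mono (R : realType) (T : Type) (D1 D2 : T -> T -> R) K :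
  0 < K -> (forall x y, D1 x y <= K * D2 x y) ->
  induced_topology D1 `<=` induced_topology D2.
Proof.
move=> K0 D12 U oU x Ux; have [e e0 xU] := oU x Ux.
exists (e / K) => [|y xy]; first exact: divr_gt0.
by apply: xU; apply: le_lt_trans (D12 x y) _; rewrite mulrC -ltr_pdivlMr.
Qed.

(** * The spectral Wasserstein distance *)

Theorem corollary4p3 (R : realType) (d : nat) (gamma : 'M[R]_d -> R)
  (gamma_norm : exists N : 'M[R]_d -> R,
     norm_on_sym N /\ forall S : 'M[R]_d, psd S -> gamma S = N S)
  (gamma_mono : forall S S' : 'M[R]_d,
     psd S -> loewner S S' -> gamma S <= gamma S') :
  is_distance (@same_measure R d) (spectral_W gamma) /\
  induced_topology (spectral_W gamma) = induced_topology (@W2 R d).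
Proof.
have [N [normN gammaN]] := gamma_norm.
have gamma_ge0 S : psd S -> 0 <= gamma S.
  by move=> pS; rewrite gammaN//; apply: norm_on_sym_ge0 => //; case: pS.
have gamma0 : gamma 0 = 0.
  have p0 : psd (0 : 'M[R]_d).
    split; first by apply/symmetricmxP; rewrite trmx0.
    by move=> v; rewrite mulmx0 mul0mx mxE.
  by rewrite gammaN// -(scale0r 0) (norm_on_symZ normN)// ?normr0 ?mul0r//; case: p0.
have [c [C [c0 C0 cC]]] := norm_on_sym_trace_equiv normN.
have W_le_W2 := @spectral_W_compare _ _ gamma (@mxtrace R d) C gamma_ge0
  (@mxtrace_psd_ge0 R d) C0.
have W2_le_W := @spectral_W_compare _ _ (@mxtrace R d) gamma c^-1
  (@mxtrace_psd_ge0 R d) gamma_ge0.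
have {}W_le_W2 mu nu : spectral_W gamma mu nu <= Num.sqrt C * W2 mu nu.
  by rewrite W2E W_le_W2// => S pS; rewrite gammaN//; case/andP: (cC S pS).
have {}W2_le_W mu nu : W2 mu nu <= Num.sqrt c^-1 * spectral_W gamma mu nu.
  rewrite W2E W2_le_W ?invr_gt0// => S pS.
  by rewrite -ler_pdivrMl ?invr_gt0// invrK gammaN//; case/andP: (cC S pS).
split; last first.
  apply/seteqP; split.
    by apply: induced_topology_mono W_le_W2; rewrite sqrtr_gt0.
  by apply: induced_topology_mono W2_le_W; rewrite sqrtr_gt0 invr_gt0.
have half_sym mu nu : spectral_W gamma mu nu <= spectral_W gamma nu mu.
  apply/ler_addgt0Pr => e e0.
  have [pi cpl h] := spectral_W_approx gamma_ge0 nu mu e0.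
  have [pi' cpl' M] := couplings_swap cpl.
  by apply: le_trans (ltW h); rewrite -M; exact: spectral_W_le.
split.
- by move=> mu nu; exact: sqrtr_ge0.
- move=> mu nu; split => [W0|mn].
    apply: couplings_null_same_measure => e e0.
    have se0 : 0 < Num.sqrt e by rewrite sqrtr_gt0.
    have [pi cpl h] := spectral_W_approx (@mxtrace_psd_ge0 R d) mu nu se0.
    exists pi => //; rewrite -ltr_sqrt//; apply: lt_le_trans h _.
    rewrite -[leRHS]add0r lerD2r -W2E.
    by apply: le_trans (W2_le_W _ _) _; rewrite W0 mulr0.
  (* The diagonal coupling has zero displacement. *)
  have [pi cpl M0] := couplings_diag mn.
  apply/eqP; rewrite eq_le sqrtr_ge0 andbT.
  by apply: le_trans (spectral_W_le gamma_ge0 cpl) _; rewrite M0 gamma0 sqrtr0.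
- by move=> mu nu; apply/eqP; rewrite eq_le !half_sym.
move=> mu nu rho; apply/ler_addgt0Pr => e e0.
have e3 : 0 < e / 3 by rewrite divr_gt0.
have [pi1 cpl1 h1] := spectral_W_approx gamma_ge0 mu nu e3.
have [pi2 cpl2 h2] := spectral_W_approx gamma_ge0 nu rho e3.
have [pi cpl h] := couplings_compose gamma_norm gamma_mono cpl1 cpl2 e3.
apply: le_trans (spectral_W_le gamma_ge0 cpl) _.
apply: le_trans h _.
by lra.
Qed.
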